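(* Let $\mathfrak{H}=\mathfrak{H}_0\oplus\mathfrak{H}_1$ be an orthogonal decomposition of a separable Hilbert space, let $A_i$ be a bounded self-adjoint operator on $\mathfrak{H}_i$ for $i=0,1$, let $V:\mathfrak{H}_1\to\mathfrak{H}_0$ be a bounded linear operator, and let $$\mathbf{B}=\begin{pmatrix} A_0 & V \\ V^* & A_1 \end{pmatrix}$$ on $\mathfrak{H}$. Then a densely defined (possibly unbounded and not necessarily closed) linear operator $X$ from $\mathfrak{H}_0$ to $\mathfrak{H}_1$ with domain $\operatorname{Dom}(X)$ is a strong solution to the Riccati equation $$A_1X-XA_0-XVX+V^*=0$$ if and only if the graph subspace $\mathcal{G}(\mathfrak{H}_0,X)$ is invariant for the operator $\mathbf{B}$.
   Context: The graph subspace of $X$ is $\mathcal{G}(\mathfrak{H}_0,X)=\{x_0\oplus Xx_0 : x_0\in\operatorname{Dom}(X)\}\subset\mathfrak{H}$. A (not necessarily closed) linear subspace $L\subset\mathfrak{H}$ is invariant for $\mathbf{B}$ if $\mathbf{B}L\subset L$. A densely defined (possibly unbounded, not necessarily closable) operator $X$ from $\mathfrak{H}_0$ to $\mathfrak{H}_1$ is a strong solution to the Riccati equation $A_1X-XA_0-XVX+V^*=0$ if $(A_0+VX)x\in\operatorname{Dom}(X)$ and $A_1Xx-X(A_0+VX)x+V^*x=0$ for every $x\in\operatorname{Dom}(X)$. *)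

(* Defs.v *)
From HB Require Import structures.
From mathcomp Require Import all_boot all_order all_algebra.
From mathcomp Require Import complex ring lra.
From mathcomp Require Import all_classical all_reals all_analysis.

Set Implicit Arguments.
Unset Strict Implicit.
Unset Printing Implicit Defensive.

Import Order.TTheory GRing.Theory Num.Theory.
Import numFieldNormedType.Exports.

Local Open Scope classical_set_scope.
Local Open Scope ring_scope.

(* Complex Hilbert spaces; the inner product is linear in its first argument.
   The norm of a normed module over R[i] takes its values in R[i]. *)
HB.mixin Record isHilbert (R : realType) H & CompleteNormedModule R[i] H := {
  inner : {dot H for @Num.conj R[i]};
  sqr_norm_inner : forall x : H, `|x| ^+ 2 = inner x x
}.

#[short(type="hilbertType")]
HB.structure Definition Hilbert (R : realType) :=
  {H of isHilbert R H & CompleteNormedModule R[i] H}.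

Definition separable (T : topologicalType) :=
  exists2 S : set T, countable S & dense S.
Arguments separable T%_type.

Section DotNorm.
Variables (C : numClosedFieldType) (U : lmodType C).
Variable f : {dot U for @Num.conj C}.

Lemma dot_conj u v : f u v = (f v u)^*.
Proof. by rewrite hermC mul1r. Qed.

Lemma dot_cauchy_schwarz u v : `|f u v| ^+ 2 <= f u u * f v v.
Proof.
have [->|v0] := eqVneq v 0.
  by rewrite linear0r normr0 expr0n mulr_ge0 ?dnorm_ge0.
have fv : 0 < f v v by rewrite dnorm_gt0.
have := dnorm_ge0 f (u - (f u v / f v v) *: v).
rewrite linearBl !linearBr/= !linearZl_LR !linearZr_LR/=.
rewrite (dot_conj v u) rmorphM/= fmorphV/= (geC0_conj (ltW fv)) => h.
have {h} : 0 <= f u u - `|f u v| ^+ 2 / f v v.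
  rewrite normCK; move: h; congr (_ <= _).
  by rewrite /GRing.scale/=; field; rewrite lt0r_neq0.
by rewrite subr_ge0 ler_pdivrMr.
Qed.

Lemma dot_triangle u v : sqrtC (f (u + v) (u + v)) <= sqrtC (f u u) + sqrtC (f v v).
Proof.
rewrite -(@ler_pXn2r _ 2) ?nnegrE ?addr_ge0 ?sqrtC_ge0 ?dnorm_ge0//.
rewrite sqrtCK sqrrD !sqrtCK dnormD [leRHS]addrAC lerD2l.
have -> : f u v + (f u v)^* = 'Re (f u v) *+ 2.
  by rewrite ReE -mulr_natr divfK ?pnatr_eq0.
rewrite lerMn2r/=.
apply: le_trans (real_ler_norm _) _; first exact: Creal_Re.
apply: le_trans (leif_normC_Re_Creal _).1 _.
rewrite -(@ler_pXn2r _ 2) ?nnegrE ?mulr_ge0 ?sqrtC_ge0 ?dnorm_ge0//.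
by rewrite exprMn !sqrtCK dot_cauchy_schwarz.
Qed.

End DotNorm.

(* The orthogonal direct sum. The library norm on a product is the maximum
   norm, hence a separate type carrying the Hilbert norm. *)
Definition dsum (R : realType) (H0 H1 : hilbertType R) : Type := (H0 * H1)%type.

Section DirectSum.
Variables (R : realType) (H0 H1 : hilbertType R).

HB.instance Definition _ := GRing.Lmodule.copy (dsum H0 H1) (H0 * H1)%type.

Definition dsum_inner (x y : dsum H0 H1) : R[i] :=
  inner x.1 y.1 + inner x.2 y.2.

Let dsum_inner_bilinear :
  bilinear_for ( *%R : GRing.Scale.law _ _) (@Num.conj R[i] \; *%R) dsum_inner.
Proof.
split=> z a u v; rewrite /dsum_inner /=.
  rewrite !linearPl/= mulrDr; ring.
rewrite !linearPr/= mulrDr; ring.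
Qed.

HB.instance Definition _ := bilinear_isBilinear.Build _ _ _ _ _ _
  dsum_inner dsum_inner_bilinear.

Let dsum_inner_herm x y :
  dsum_inner x y = (-1) ^+ false * Num.conj (dsum_inner y x).
Proof. by rewrite /dsum_inner mul1r rmorphD/= -!dot_conj. Qed.

HB.instance Definition _ := isHermitianSesquilinear.Build _ _ _ _
  dsum_inner dsum_inner_herm.

Let dsum_inner_gt0 x : x != 0 -> 0 < dsum_inner x x.
Proof.
move=> x0; rewrite /dsum_inner lt0r addr_ge0 ?dnorm_ge0// andbT.
rewrite paddr_eq0 ?dnorm_ge0// !dnorm_eq0.
by apply: contra x0; case: x => a b /= /andP[/eqP-> /eqP->].
Qed.

HB.instance Definition _ := isDotProduct.Build _ _ dsum_inner dsum_inner_gt0.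

Let dsum_norm (x : dsum H0 H1) : R[i] := sqrtC (dsum_inner x x).

Let dsum_normD x y : dsum_norm (x + y) <= dsum_norm x + dsum_norm y.
Proof. exact: (dot_triangle dsum_inner). Qed.

Let dsum_normZ (a : R[i]) x : dsum_norm (a *: x) = `|a| * dsum_norm x.
Proof.
rewrite /dsum_norm (dnormZ dsum_inner) sqrtCM ?nnegrE ?exprn_ge0//.
by rewrite sqrCK.
Qed.

Let dsum_norm_eq0 x : dsum_norm x = 0 -> x = 0.
Proof. by move/eqP; rewrite (sqrt_dnorm_eq0 dsum_inner) => /eqP. Qed.

HB.instance Definition _ := Lmodule_isNormed.Build R[i] (dsum H0 H1)
  dsum_normD dsum_normZ dsum_norm_eq0.

Lemma dsum_sqr_norm (x : dsum H0 H1) : `|x| ^+ 2 = dsum_inner x x.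
Proof. exact: sqrtCK. Qed.

Lemma dsum_norm_fst (x : dsum H0 H1) : `|x.1| <= `|x|.
Proof.
rewrite -(@ler_pXn2r _ 2) ?nnegrE// dsum_sqr_norm /dsum_inner sqr_norm_inner.
by rewrite lerDl dnorm_ge0.
Qed.

Lemma dsum_norm_snd (x : dsum H0 H1) : `|x.2| <= `|x|.
Proof.
rewrite -(@ler_pXn2r _ 2) ?nnegrE// dsum_sqr_norm /dsum_inner sqr_norm_inner.
by rewrite lerDr dnorm_ge0.
Qed.

Lemma dsum_norm_le (x : dsum H0 H1) : `|x| <= `|x.1| + `|x.2|.
Proof.
rewrite -(@ler_pXn2r _ 2) ?nnegrE ?addr_ge0// dsum_sqr_norm /dsum_inner.
rewrite sqrrD !sqr_norm_inner addrAC lerDl.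
by rewrite mulrn_wge0// mulr_ge0.
Qed.

Let dsum_complete (F : set_system (dsum H0 H1)) :
  ProperFilter F -> cauchy F -> cvg F.
Proof.
move=> FF /cauchy_ballP Fc.
have c1 : cvg (fst @ F).
  apply/cauchy_cvgP/cauchy_ballP => e e0; rewrite !near_map2.
  apply: filterS2 (Fc e e0) (Fc e e0) => [[x y]] h _.
  move: h; rewrite -!ball_normE /= => h; apply: le_lt_trans h.
  exact: (dsum_norm_fst (x - y)).
have c2 : cvg (snd @ F).
  apply/cauchy_cvgP/cauchy_ballP => e e0; rewrite !near_map2.
  apply: filterS2 (Fc e e0) (Fc e e0) => [[x y]] h _.
  move: h; rewrite -!ball_normE /= => h; apply: le_lt_trans h.
  exact: (dsum_norm_snd (x - y)).
apply/cvg_ex; exists ((lim (fst @ F), lim (snd @ F)) : dsum H0 H1).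
apply/cvgrPdist_lt => e e0.
have e20 : 0 < e / 2 by rewrite divr_gt0.
move/cvgrPdist_lt : c1 => /(_ _ e20) c1.
move/cvgrPdist_lt : c2 => /(_ _ e20) c2.
apply: filterS2 c1 c2 => x h1 h2.
apply: le_lt_trans (dsum_norm_le _) _.
by rewrite (splitr e) ltrD.
Qed.

HB.instance Definition _ := Uniform_isComplete.Build (dsum H0 H1) dsum_complete.

HB.instance Definition _ := isHilbert.Build R (dsum H0 H1) dsum_sqr_norm.

End DirectSum.

Notation "H0 \oplus H1" := (dsum H0 H1)
  (at level 50, left associativity) : type_scope.

Section Riesz.
Variables (R : realType) (H : hilbertType R) (phi : {scalar H}) (M : R[i]).
Hypothesis phi_bounded : forall x, `|phi x| <= M * `|x|.

Let sq (x : H) : R := complex.Re (inner x x).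
Let J (x : H) : R := sq x - complex.Re (phi x) *+ 2.
Let N (x : H) : R := complex.Re `|x|.

Let ReD (a b : R[i]) : complex.Re (a + b) = complex.Re a + complex.Re b.
Proof. by case: a b => ? ? []. Qed.

Let ReN (a : R[i]) : complex.Re (- a) = - complex.Re a.
Proof. by case: a. Qed.

Let ReZ (t : R) (a : R[i]) : complex.Re (t%:C%C * a) = t * complex.Re a.
Proof. by case: a => a b /=; rewrite mul0r subr0. Qed.

Let Re_conj (a : R[i]) : complex.Re (Num.conj a) = complex.Re a.
Proof. by case: a. Qed.

Let Re_le (a : R[i]) : complex.Re a <= complex.Re `|a|.
Proof.
case: a => a b; rewrite normc_def /=.
apply: le_trans (ler_norm a) _; rewrite -sqrtr_sqr ler_sqrt ?lerDl ?sqr_ge0//.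
by rewrite addr_ge0 ?sqr_ge0.
Qed.

Let posC (z : R[i]) : 0 <= z -> z = (complex.Re z)%:C%C.
Proof. by case: z => a b; rewrite lecE /= => /andP[/eqP-> _]. Qed.

Let NE x : `|x| = (N x)%:C%C.
Proof. exact: posC. Qed.

Let N_ge0 x : 0 <= N x.
Proof. by have := normr_ge0 x; rewrite NE lecR. Qed.

Let sqE x : sq x = N x ^+ 2.
Proof. by rewrite /sq -sqr_norm_inner NE -rmorphXn. Qed.

Let sq_ge0 x : 0 <= sq x.
Proof. by rewrite sqE sqr_ge0. Qed.

Let sqD x y : sq (x + y) = sq x + complex.Re (inner y x) *+ 2 + sq y.
Proof.
rewrite /sq linearDl !linearDr /= !ReD (dot_conj _ x y) Re_conj; lra.
Qed.

Let sqZ (t : R) x : sq (t%:C%C *: x) = t ^+ 2 * sq x.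
Proof.
rewrite !sqE /N normrZ.
have -> : `|t%:C%C| = `|t|%:C%C :> R[i].
  by rewrite normc_def /= expr0n addr0 sqrtr_sqr.
by rewrite ReZ exprMn real_normK ?num_real.
Qed.

Let J_step x (t : R) h :
  J (x + t%:C%C *: h) =
  J x + t * complex.Re (inner h x - phi h) *+ 2 + t ^+ 2 * sq h.
Proof.
rewrite /J sqD sqZ linearZl_LR /= (linearD phi) (scalarZ phi) !ReD ReN !ReZ; lra.
Qed.

Let J_lb x : - (complex.Re M) ^+ 2 <= J x.
Proof.
have : complex.Re (phi x) <= complex.Re M * N x.
  apply: le_trans (Re_le _) _; have := phi_bounded x.
  rewrite lecE => /andP[_]; rewrite NE mulrC.
  by rewrite ReZ mulrC.
rewrite /J sqE; move: (N x) (complex.Re M) (complex.Re _) => n m r h.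
have := sqr_ge0 (n - m); rewrite sqrrB; lra.
Qed.

Let m := inf (range J).

Let m_le x : m <= J x.
Proof.
apply: ge_inf; last by exists x.
by exists (- complex.Re M ^+ 2) => _ [y _ <-]; exact: J_lb.
Qed.

Let near_min (e : R) := [set x | J x < m + e].

Let near_min_neq0 e : 0 < e -> near_min e !=set0.
Proof.
move=> e0; have [|_ [x _ <-] h] := @inf_adherent _ (range J) _ e0; last by exists x.
split; first by exists (J 0), 0.
by exists (- complex.Re M ^+ 2) => _ [y _ <-]; exact: J_lb.
Qed.

Let near_min_close e x y : near_min e x -> near_min e y -> sq (x - y) < 4 * e.
Proof.
rewrite /near_min /= => hx hy.
pose h := y - x; have yE : y = x + 1%:C%C *: h by rewrite scale1r addrC subrK.
have := m_le (x + (2^-1)%:C%C *: h); rewrite J_step.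
move: hy; rewrite {1}yE J_step.
have -> : sq (x - y) = sq h.
  by rewrite !sqE /N -normrN opprB.
by move: (complex.Re _) => c; lra.
Qed.

Let F : set_system H := filter_from [set e : R | 0 < e] near_min.

Local Instance F_proper : ProperFilter F.
Proof.
apply: filter_from_proper; last by move=> e /near_min_neq0.
apply: filter_from_filter; first by exists 1 => /=.
move=> e1 e2 /= h1 h2; exists (Num.min e1 e2).
  by rewrite /= lt_min h1.
by move=> x; rewrite /near_min /= => h; split; apply: (lt_le_trans h);
  rewrite lerD2l ge_min lexx ?orbT.
Qed.

Let posR (e : R[i]) : 0 < e -> exists2 r : R, 0 < r & e = r%:C%C.
Proof.
move=> e0; exists (complex.Re e); last exact: posC (ltW e0).
by rewrite -ltcR -posC ?ltW.
Qed.

Let F_cvg : cvg F.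
Proof.
apply/cauchy_cvgP/cauchy_ballP => _ /posR[r r0 ->].
have Fe : F (near_min (r ^+ 2 / 4)) by exists (r ^+ 2 / 4) => //=; rewrite divr_gt0 ?exprn_gt0.
pose E := near_min (r ^+ 2 / 4); exists (E, E) => // -[x y] /= [hx hy]; rewrite -ball_normE /= NE ltcR.
have := near_min_close hx hy; rewrite sqE.
rewrite mulrCA divff ?mulr1 ?pnatr_eq0// => h.
by rewrite -(@ltr_pXn2r _ 2) ?nnegrE// ltW.
Qed.

Let z := lim F.

Let crit h : complex.Re (inner h z - phi h) = 0.
Proof.
set c := fun x => complex.Re (inner h x - phi h).
have c_near e x : 0 < e -> near_min e x -> c x ^+ 2 <= e * (sq h + 1).
  move=> e0; rewrite /near_min /= => hx.
  have a1 : 0 < sq h + 1 by rewrite ltr_wpDl.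
  have := m_le (x + (- (c x / (sq h + 1)))%:C%C *: h).
  rewrite J_step -/(c x) -ler_pdivrMr//.
  have -> : J x + - (c x / (sq h + 1)) * c x *+ 2 +
      (- (c x / (sq h + 1))) ^+ 2 * sq h =
      J x - c x ^+ 2 / (sq h + 1) - c x ^+ 2 / (sq h + 1) ^+ 2.
    by field; rewrite lt0r_neq0.
  have : 0 <= c x ^+ 2 / (sq h + 1) ^+ 2 by rewrite divr_ge0 ?sqr_ge0.
  lra.
have c_dist x : (c z - c x) ^+ 2 <= sq h * sq (z - x).
  have -> : c z - c x = complex.Re (inner h (z - x)).
    rewrite /c linearBr /= !ReD !ReN; lra.
  have := dot_cauchy_schwarz inner h (z - x).
  have w0 := normr_ge0 (inner h (z - x)); rewrite [X in X ^+ 2](posC w0).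
  rewrite -!sqr_norm_inner !NE -!rmorphXn -rmorphM lecR !sqE.
  apply: le_trans; rewrite -[leLHS]real_normK ?num_real//.
  rewrite ler_pXn2r ?nnegrE//; last first.
    by have := w0; rewrite {1}(posC w0) lecR.
  rewrite ler_norml Re_le andbT lerNl -ReN.
  by apply: le_trans (Re_le _) _; rewrite normrN.
rewrite -/(c z); apply/eqP; apply: contraT => cz0; suff: False by []; have cz : 0 < c z ^+ 2 by rewrite exprn_even_gt0.
have a1 : 0 < sq h + 1 by rewrite ltr_wpDl.
pose e := c z ^+ 2 / (8 * (sq h + 1)).
have e0 : 0 < e by apply: divr_gt0 => //; rewrite mulr_gt0 ?ltr0n.
have Fe : F (near_min e) by exists e.
have Fz : F [set x | sq (z - x) < e].
  have s0 : 0 < (Num.sqrt e)%:C%C by rewrite ltcR sqrtr_gt0.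
  apply: filterS (F_cvg (nbhsx_ballx z _ s0)) => x.
  rewrite -ball_normE /= NE ltcR sqE => hx.
  by rewrite -[ltRHS]sqr_sqrtr ?(ltW e0)// ltr_pXn2r ?nnegrE.
have [x [/(c_near _ _ e0) h1 h2]] := filter_ex (filterI Fe Fz).
have {}h2 : (c z - c x) ^+ 2 <= sq h * e.
  by apply: le_trans (c_dist x) _; apply: ler_wpM2l => //; exact: ltW.
have eE : e * (sq h + 1) * 8 = c z ^+ 2.
  by rewrite /e; field; rewrite lt0r_neq0.
have := sqr_ge0 (c z - c x *+ 2).
move: h1 h2 eE cz e0; nra.
Qed.

Lemma riesz : exists z : H, forall x, phi x = inner x z.
Proof.
exists z => h; apply/esym/eqP; rewrite -subr_eq0; apply/eqP.
have h1 := crit h; have := crit (Complex 0 1 *: h).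
rewrite linearZl_LR (scalarZ phi) /= -mulrBr.
case: (inner h z - phi h) h1 => a b /= -> /=.
by rewrite mul0r add0r mul1r => /eqP; rewrite oppr_eq0 => /eqP ->.
Qed.

End Riesz.

HB.mixin Record isBoundedOp (R : realType) (U V : hilbertType R) (f : U -> V) := {
  op_bounded : exists M : R[i], forall x, `|f x| <= M * `|x|
}.

#[short(type="boundedOp")]
HB.structure Definition BoundedOp (R : realType) (U V : hilbertType R) :=
  {f of isBoundedOp R U V f & @GRing.Linear R[i] U V *:%R f}.

Notation "{ 'bounded' U -> V }" := (boundedOp U%type V%type)
  (at level 0, U at level 98, V at level 99,
   format "{ 'bounded'  U  ->  V }") : type_scope.

Lemma inner_inj (R : realType) (W : hilbertType R) (a b : W) :
  (forall x, inner x a = inner x b) -> a = b.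
Proof.
move=> h; apply/eqP; rewrite -subr_eq0 -(dnorm_eq0 inner) linearBr /= h subrr//.
Qed.

Section Adjoint.
Variables (R : realType) (U V : hilbertType R) (T : {bounded U -> V}).

Definition adjoint (y : V) : U :=
  get [set z | forall x, inner (T x) y = inner x z].

Lemma adjointP x y : inner (T x) y = inner x (adjoint y).
Proof.
have [M TM] := @op_bounded _ _ _ T.
suff [z hz] : exists z, forall x, inner (T x) y = inner x z.
  exact: (@getPex _ [set z | forall x, inner (T x) y = inner x z]
    (ex_intro _ z hz) x).
pose phi x := inner (T x) y.
have phi_lin : scalar phi.
  by move=> a u v; rewrite /phi linearP linearPl.
pose phiL := GRing.isLinear.Build _ _ _ _ phi phi_lin.
pose phi' : {scalar U} := HB.pack phi phiL.
apply: (@riesz _ _ phi' (M * `|y|)) => {}x.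
have TM0 : 0 <= M * `|x| by apply: le_trans (TM x).
rewrite -(@ler_pXn2r _ 2) ?nnegrE//; last by rewrite mulrAC mulr_ge0.
apply: le_trans (dot_cauchy_schwarz _ _ _) _.
rewrite -!sqr_norm_inner -exprMn [M * _ * _]mulrAC.
have RHS0 : 0 <= M * `|x| * `|y| by exact: mulr_ge0.
rewrite ler_pXn2r ?nnegrE//; exact: ler_wpM2r.
Qed.

Let adjoint_linear : linear adjoint.
Proof.
move=> a u v; apply: inner_inj => x.
by rewrite -adjointP !linearPr/= !adjointP.
Qed.

HB.instance Definition _ := GRing.isLinear.Build _ _ _ _ adjoint adjoint_linear.

Let adjoint_bounded : exists M : R[i], forall y, `|adjoint y| <= M * `|y|.
Proof.
have [M TM] := @op_bounded _ _ _ T; exists `|M| => y.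
have [->|a0] := eqVneq (adjoint y) 0; first by rewrite normr0 mulr_ge0.
have a_gt0 : 0 < `|adjoint y| by rewrite normr_gt0.
rewrite -(ler_pM2l a_gt0) -expr2 sqr_norm_inner -adjointP.
rewrite -(@ler_pXn2r _ 2) ?nnegrE ?mulr_ge0 ?dnorm_ge0//; last first.
  by rewrite adjointP dnorm_ge0.
have TMn x : `|T x| <= `|M| * `|x|.
  rewrite -[X in _ * X]normr_id -normrM ger0_norm ?TM//.
  exact: le_trans (TM x).
have p0 : 0 <= inner (T (adjoint y)) y by rewrite adjointP dnorm_ge0.
rewrite -[X in X ^+ 2 <= _](ger0_norm p0).
apply: le_trans (dot_cauchy_schwarz _ _ _) _.
rewrite -!sqr_norm_inner -exprMn mulrA.
rewrite ler_pXn2r ?nnegrE ?mulr_ge0// ler_wpM2r// mulrC.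
by rewrite (le_trans (TMn _)).
Qed.

HB.instance Definition _ := isBoundedOp.Build _ _ _ adjoint adjoint_bounded.

End Adjoint.

Section BlockOperator.
Variables (R : realType) (H0 H1 : hilbertType R).
Variables (A : {bounded H0 -> H0}) (B : {bounded H1 -> H0}).
Variables (C : {bounded H0 -> H1}) (D : {bounded H1 -> H1}).

(* The operator with block matrix (A B; C D). *)
Definition block_op (h : H0 \oplus H1) : H0 \oplus H1 :=
  (A h.1 + B h.2, C h.1 + D h.2).

Let block_op_linear : linear block_op.
Proof.
move=> a x y; apply/pair_equal_spec; split => /=.
  by rewrite !linearP scalerDr addrACA.
by rewrite !linearP scalerDr addrACA.
Qed.

HB.instance Definition _ :=
  GRing.isLinear.Build _ _ _ _ block_op block_op_linear.

Let block_op_bounded : exists M : R[i], forall x, `|block_op x| <= M * `|x|.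
Proof.
have norm_bound (U W : hilbertType R) (T : {bounded U -> W}) :
    exists2 M : R[i], 0 <= M & forall x, `|T x| <= M * `|x|.
  have [M TM] := @op_bounded _ _ _ T; exists `|M| => // x.
  rewrite -[X in _ * X]normr_id -normrM ger0_norm ?TM//.
  exact: le_trans (TM x).
have [MA A0 hA] := norm_bound _ _ A; have [MB B0 hB] := norm_bound _ _ B.
have [MC C0 hC] := norm_bound _ _ C; have [MD D0 hD] := norm_bound _ _ D.
have h1 M (x : H0 \oplus H1) : 0 <= M -> M * `|x.1| <= M * `|x|.
  by move=> M0; apply: ler_wpM2l => //; exact: dsum_norm_fst.
have h2 M (x : H0 \oplus H1) : 0 <= M -> M * `|x.2| <= M * `|x|.
  by move=> M0; apply: ler_wpM2l => //; exact: dsum_norm_snd.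
exists (MA + MB + (MC + MD)) => x.
apply: le_trans (dsum_norm_le _) _; rewrite !mulrDl; apply: lerD.
  apply: le_trans (ler_normD _ _) _; apply: lerD.
    exact: le_trans (hA _) (h1 _ _ A0).
  exact: le_trans (hB _) (h2 _ _ B0).
apply: le_trans (ler_normD _ _) _; apply: lerD.
  exact: le_trans (hC _) (h1 _ _ C0).
exact: le_trans (hD _) (h2 _ _ D0).
Qed.

HB.instance Definition _ := isBoundedOp.Build _ _ _ block_op block_op_bounded.

End BlockOperator.

Definition selfadjoint (R : realType) (H : hilbertType R)
  (A : {bounded H -> H}) := adjoint A =1 A.

(* Linear operators defined on a linear subspace [dom], with no boundedness,
   density or closability requirement. The underlying function is total, but
   its values outside [dom] are arbitrary and carry no meaning. *)
Record unboundedOp (R : realType) (U V : hilbertType R) := UnboundedOp {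
  dom : set U;
  unbounded_fun :> U -> V;
  dom_submod : submod_closed (mem dom);
  unbounded_linear : forall (a : R[i]) x y, dom x -> dom y ->
    unbounded_fun (a *: x + y) = a *: unbounded_fun x + unbounded_fun y
}.

Definition densely_defined (R : realType) (U V : hilbertType R)
  (X : unboundedOp U V) := dense (dom X).

Definition graph (R : realType) (H0 H1 : hilbertType R)
  (X : unboundedOp H0 H1) : set (H0 \oplus H1) := [set (x, X x) | x in dom X].

Lemma graph_submod (R : realType) (H0 H1 : hilbertType R)
  (X : unboundedOp H0 H1) : submod_closed (mem (graph X)).
Proof.
have [D0 DP] := dom_submod X; have X0 : X 0 = 0.
  have d0 : dom X 0 by apply: set_mem.
  have := unbounded_linear 1 d0 d0; rewrite !scale1r addr0.
  by rewrite -[LHS]addr0 => /addrI.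
split; first by apply/mem_set; exists 0; [exact: set_mem | rewrite X0].
move=> a _ _ /set_mem[x dx <-] /set_mem[y dy <-]; apply/mem_set.
exists (a *: x + y); last by rewrite unbounded_linear.
by apply/set_mem/DP; exact/mem_set.
Qed.

Definition invariant_subspace (R : realType) (H : hilbertType R)
  (B : {bounded H -> H}) (L : set H) := B @` L `<=` L.

(* A1 X - X A0 - X V X + V^* = 0; only the sum A0 x + V (X x) is required to
   lie in the domain of X, not its two terms separately. *)
Definition strong_riccati_solution (R : realType) (H0 H1 : hilbertType R)
    (A0 : {bounded H0 -> H0}) (A1 : {bounded H1 -> H1})
    (V : {bounded H1 -> H0}) (X : unboundedOp H0 H1) :=
  forall x, dom X x -> dom X (A0 x + V (X x)) /\
    A1 (X x) - X (A0 x + V (X x)) + adjoint V x = 0.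

(* Main.v *)
Require Import Defs.
From HB Require Import structures.
From mathcomp Require Import all_boot all_order all_algebra.
From mathcomp Require Import complex.
From mathcomp Require Import all_classical all_reals all_analysis.

(** For [x] in [dom X], the block operator sends [(x, X x)] to
    [(A0 x + V (X x), adjoint V x + A1 (X x))]. This pair lies on the graph exactly when its first
    entry is in [dom X] and [X] maps it to the second entry, which is the Riccati equation
    rearranged. The argument is purely algebraic and pointwise in [x]. *)

Theorem theorem2p4 (R : realType) (H0 H1 : hilbertType R)
    (hsep : separable (H0 \oplus H1))
    (A0 : {bounded H0 -> H0}) (A1 : {bounded H1 -> H1})
    (hA0 : selfadjoint A0) (hA1 : selfadjoint A1)
    (V : {bounded H1 -> H0})
    (X : unboundedOp H0 H1) (hX : densely_defined X) :
  strong_riccati_solution A0 A1 V X <->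
  invariant_subspace (block_op A0 V (adjoint V) A1) (graph X).
Proof.
(* The right-hand side is ordered as the second entry of [block_op]. *)
have riccatiE a b c : (a - b + c = 0 :> H1)%R <-> (b = c + a)%R.
  rewrite GRing.addrAC (GRing.addrC c); split.
    by move/eqP; rewrite GRing.subr_eq0 => /eqP.
  by move=> ->; rewrite GRing.subrr.
split.
  move=> sol _ [_ [x dx <-] <-]; have [dy /riccatiE Xy] := sol x dx.
  by exists (A0 x + V (X x))%R; rewrite // Xy.
move=> inv x dx.
(* Comparing first entries forces [y = A0 x + V (X x)], so [dy] is the domain condition and [Xy] the
   equation. *)
have [|y dy [yE Xy]] := inv (block_op A0 V (adjoint V) A1 (x, X x)).
  by exists (x, X x) => //; exists x.
by rewrite riccatiE -yE.
Qed.
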